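(* Suppose $(\alpha_n)$ is chosen so that $d_n^*$ is odd for all $n$ and $\lambda_n\to\lambda\in(0,1)$. Then the probability that there is a unique shortest path from vertex $1$ to vertex $2$ in $G_n$ and that it has length $d_n^*$ converges to $\lambda\log(1/\lambda)$.
   Context: Let $(\alpha_n)$ be a sequence in $(0,\infty)$ with $0<\liminf\alpha_n\le\limsup\alpha_n<\infty$, $q_n=\alpha_n\log n/n$, $G_n\sim\mathcal G(n,q_n)$ on $\{1,\dots,n\}$, $d_n^*=\min\{d\in\mathbb Z:(nq_n)^d\ge n/(\log\log n)^2\}$, and $\lambda_n\in(0,1)$ defined by $\log(1/\lambda_n)=(nq_n)^{d_n^*}/n$. *)

(* Defs.v *)
From HB Require Import structures.
From mathcomp Require Export all_boot all_order all_algebra.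
From mathcomp Require Export all_classical all_reals all_analysis.

Set Implicit Arguments.
Unset Strict Implicit.
Unset Printing Implicit Defensive.

Import Order.TTheory GRing.Theory Num.Theory.
Import numFieldNormedType.Exports.

Local Open Scope classical_set_scope.
Local Open Scope ring_scope.

Definition vertex_pairs (T : finType) : {set {set T}} :=
  [set e : {set T} | #|e| == 2%N]%SET.

Record sgraph (T : finType) := SGraph {
  edges :> {set {set T}};
  edges_sub : edges \subset vertex_pairs T }.

HB.instance Definition _ (T : finType) := [isSub for @edges T].
HB.instance Definition _ (T : finType) := [Finite of sgraph T by <:].

Definition adj (T : finType) (G : sgraph T) : rel T :=
  fun x y => [set x; y]%SET \in edges G.

(* A path from u to v is u :: p, with pairwise distinct vertices; its length
   (number of edges) is size p. *)
Definition is_path (T : finType) (G : sgraph T) (u v : T) (p : seq T) : Prop :=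
  [/\ path (adj G) u p, last u p = v & uniq (u :: p)].

Definition shortest_path (T : finType) (G : sgraph T) (u v : T) (p : seq T) :
    Prop :=
  is_path G u v p /\ forall p', is_path G u v p' -> (size p <= size p')%N.

Definition unique_shortest_path_of_length (T : finType) (G : sgraph T)
    (u v : T) (d : int) : Prop :=
  exists p, unique (shortest_path G u v) p /\ (size p)%:Z = d.

(* The law of G(n, q): every pair of vertices is an edge independently with
   probability q.  It is a probability when 0 <= q <= 1. *)
Definition er_mass (R : realType) (T : finType) (q : R) (G : sgraph T) : R :=
  \prod_(e in vertex_pairs T) (if e \in edges G then q else 1 - q).

Definition er_prob (R : realType) (T : finType) (q : R) (A : set (sgraph T)) :
    R :=
  \sum_(G : sgraph T | G \in A) er_mass q G.

Definition edge_prob (R : realType) (alpha : R^nat) (n : nat) : R :=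
  alpha n * ln n%:R / n%:R.

Definition dstar_set (R : realType) (alpha : R^nat) (n : nat) : set int :=
  [set d : int |
    n%:R / ln (ln n%:R) ^+ 2 <= (n%:R * edge_prob alpha n) ^ d].

(* The minimum of dstar_set. It exists as soon as n * edge_prob alpha n > 1
   and ln (ln n) != 0, hence for all large n when alpha is bounded away from 0;
   the default value 0 is used otherwise. *)
Definition dstar (R : realType) (alpha : R^nat) (n : nat) : int :=
  xget 0 (dstar_set alpha n `&` lbound (dstar_set alpha n)).

(* The solution of ln (1 / x) = (n q_n)^(d*_n) / n, see ln_lambda_seq. *)
Definition lambda_seq (R : realType) (alpha : R^nat) (n : nat) : R :=
  expR (- ((n%:R * edge_prob alpha n) ^ dstar alpha n / n%:R)).

Lemma ln_lambda_seq (R : realType) (alpha : R^nat) (n : nat) :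
  ln (1 / lambda_seq alpha n) =
  (n%:R * edge_prob alpha n) ^ dstar alpha n / n%:R.
Proof. by rewrite /lambda_seq expRN div1r invrK expRK. Qed.

Lemma lambda_seq_itv (R : realType) (alpha : R^nat) (n : nat) :
  (forall m, 0 < alpha m) -> (1 < n)%N -> 0 < lambda_seq alpha n < 1.
Proof.
move=> a0 n1; have n0 : 0 < n%:R :> R by rewrite ltr0n ltnW.
rewrite expR_gt0 /= -expR0 ltr_expR oppr_lt0 divr_gt0 ?exprz_gt0 //.
by rewrite mulr_gt0 // divr_gt0 // mulr_gt0 // ln_gt0 // ltr1n.
Qed.

(* Main.v *)
(* Write N = n q and c = log (1 / lambda).  The number X of open paths of length
   d = d* from 1 to 2 has mean about N^d / n -> c, while the expected number of
   strictly shorter paths is at most 2 N^(d-1) / n = O(1 / N).  So the event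
   differs from {X = 1} by o(1), and it remains to see that X is asymptotically
   Poisson.  The Stein-Chen method reduces this to showing that, for a fixed
   path P, the expected number of open paths Q <> P sharing an edge with P, given
   that P is open, tends to 0.  Reading Q edge by edge, a shared edge following
   an unshared one costs a choice among the d + 1 vertices of P, whereas a shared
   edge following a shared one is forced; this gives a bound O(d / N), and
   d / N -> 0 because d is of order log n / log log n and N of order log n. *)
From mathcomp Require Import ring lra zify.
Require Import Defs.

Set Implicit Arguments.
Unset Strict Implicit.
Unset Printing Implicit Defensive.

Import Order.TTheory GRing.Theory Num.Theory.
Import numFieldNormedType.Exports.

Local Open Scope classical_set_scope.
Local Open Scope ring_scope.

(** * Stein's equation for the Poisson mass at 1: its solution and a uniform bound *)

Lemma fact_mul_le (m n : nat) : (m`! * n`! <= (m + n)`!)%N.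
Proof.
rewrite -(bin_fact (leq_addr n m)) addKn.
by rewrite leq_pmull // bin_gt0 leq_addr.
Qed.

Section SteinSolution.
Variables (R : realType) (c : R).
Hypothesis c_gt0 : 0 < c.

Local Notation S := (series (exp_coeff c)).

Lemma series_exp_le (n : nat) : S n <= expR c.
Proof.
apply: nondecreasing_cvgn_le; last exact: is_cvg_series_exp_coeff.
apply/nondecreasing_seqP => m; rewrite seriesSr lerDl.
exact/exp_coeff_ge0/ltW.
Qed.

Lemma exp_coeff_add_le (j i : nat) :
  exp_coeff c (j + i) <= exp_coeff c j * exp_coeff c i.
Proof.
rewrite /exp_coeff /= exprD mulrACA -invfM -natrM.
rewrite ler_pM2l ?mulr_gt0 ?exprn_gt0 // lef_pV2 ?posrE ?ltr0n ?fact_gt0 //.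
- by rewrite ler_nat fact_mul_le.
- by rewrite muln_gt0 !fact_gt0.
Qed.

(** Since [j! i! <= (j + i)!], each term of the tail is at most [exp_coeff c j] times a term of the
    exponential series, and those terms add up to at most [expR c]. *)
Lemma expR_tail_le (j : nat) : expR c - S j.+1 <= exp_coeff c j * expR c.
Proof.
rewrite lerBlDl; apply: limr_le; first exact: is_cvg_series_exp_coeff.
near=> m; have jm : (j.+1 <= m)%N by near: m; exists j.+1.
rewrite -(subnK jm) addnC /series /= -lerBlDl.
rewrite (big_cat_nat (n := j.+1)) //= ?leq_addr // addrAC subrr add0r.
rewrite -{1}(add0n j.+1) big_addn addKn.
apply: (@le_trans _ _
    (\sum_(0 <= i < m - j.+1) exp_coeff c j * exp_coeff c i.+1)).
  apply: ler_sum => i _; rewrite addnS addnC -addnS; exact: exp_coeff_add_le.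
rewrite -mulr_sumr ler_wpM2l //; first exact/exp_coeff_ge0/ltW.
apply: le_trans (series_exp_le (m - j.+1).+1).
rewrite /series /= big_nat_recl //= lerDr; exact/exp_coeff_ge0/ltW.
Unshelve. all: by end_near.
Qed.

(* The solution f of Stein's equation
   c f (j + 1) - j f j = 1_{j = 1} - P (Poisson(c) = 1). *)
Definition stein_sol (j : nat) : R :=
  match j with
  | 0 => 0
  | 1 => - expR (- c)
  | j'.+1 => (exp_coeff c j')^-1 * (1 - expR (- c) * S j)
  end.

Lemma stein_solE (j : nat) :
  c * stein_sol j.+1 - j%:R * stein_sol j = (j == 1%N)%:R - c * expR (- c).
Proof.
have c0 : c != 0 by rewrite gt_eqF.
case: j => [|[|j]] /=.
- by rewrite mul0r; ring.
- rewrite /series /= big_nat_recr // big_nat1 /= /exp_coeff /= !fact0 expr0 expr1.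
  by rewrite (_ : 1`! = 1%N) // ; field.
rewrite (seriesSr _ j.+2).
have -> : exp_coeff c j.+2 = exp_coeff c j.+1 * (c / j.+2%:R).
  rewrite /exp_coeff /= factS natrM exprS; field.
  by rewrite -natrD !pnatr_eq0 -!lt0n fact_gt0.
have : exp_coeff c j.+1 != 0.
  by rewrite mulf_neq0 ?expf_neq0 // invr_neq0 // pnatr_eq0 -lt0n fact_gt0.
move: (exp_coeff c j.+1) (S j.+2) => a s a0; field.
by rewrite a0 c0 /= -natrD pnatr_eq0.
Qed.

(** From index 2 on, the bracket is [expR (- c)] times a tail of the exponential series, and
    [expR_tail_le] bounds that tail by the very coefficient that is divided out. *)
Lemma stein_sol_le1 (j : nat) : `|stein_sol j| <= 1.
Proof.
case: j => [|[|j]] /=.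
- by rewrite normr0.
- by rewrite normrN ger0_norm ?expR_ge0 // -expR0 ler_expR oppr_le0 ltW.
have a0 : 0 < exp_coeff c j.+1.
  by rewrite divr_gt0 ?exprn_gt0 // ltr0n fact_gt0.
have e0 := expR_gt0 c; rewrite expRN.
have -> : 1 - (expR c)^-1 * S j.+2 = (expR c)^-1 * (expR c - S j.+2).
  by rewrite mulrBr mulVf // gt_eqF.
rewrite ger0_norm; last first.
  by rewrite !mulr_ge0 ?invr_ge0 ?subr_ge0 ?series_exp_le // ltW.
rewrite mulrA -invfM [leLHS]mulrC ler_pdivrMr ?(mulr_gt0 a0 e0) // mul1r.
exact: expR_tail_le.
Qed.

End SteinSolution.

(** * Expectations over a finite weighted space *)

Definition mean (R : realType) (W : finType) (m : W -> R) (g : W -> R) : R :=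
  \sum_w m w * g w.

Section Mean.
Variables (R : realType) (W : finType) (m : W -> R).
Local Notation E := (mean m).

Lemma eq_mean (f g : W -> R) : f =1 g -> E f = E g.
Proof. by move=> fg; apply: eq_bigr => w _; rewrite fg. Qed.

Lemma meanD (f g : W -> R) : E (fun w => f w + g w) = E f + E g.
Proof. by rewrite -big_split; apply: eq_bigr => w _; rewrite mulrDr. Qed.

Lemma meanZ (a : R) (f : W -> R) : E (fun w => a * f w) = a * E f.
Proof. by rewrite [RHS]mulr_sumr; apply: eq_bigr => w _; rewrite mulrCA. Qed.

Lemma meanB (f g : W -> R) : E (fun w => f w - g w) = E f - E g.
Proof. by rewrite -sumrB; apply: eq_bigr => w _; rewrite mulrBr. Qed.

Lemma mean_sum (I : Type) (s : seq I) (P : pred I) (f : I -> W -> R) :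
  E (fun w => \sum_(i <- s | P i) f i w) = \sum_(i <- s | P i) E (f i).
Proof. by rewrite exchange_big; apply: eq_bigr => w _; rewrite mulr_sumr. Qed.

Lemma mean_indic (P : pred W) : E (fun w => (P w)%:R) = \sum_(w | P w) m w.
Proof.
rewrite [RHS]big_mkcond; apply: eq_bigr => w _.
by case: (P w); rewrite ?mulr1 ?mulr0.
Qed.

Hypothesis m_ge0 : forall w, 0 <= m w.

Lemma mean_norm (f g : W -> R) : (forall w, `|f w| <= g w) -> `|E f| <= E g.
Proof.
move=> fg; apply: le_trans (ler_norm_sum _ _ _) _.
by apply: ler_sum => w _; rewrite normrM ger0_norm // ler_wpM2l.
Qed.

End Mean.

(** * The Stein-Chen bound for sums of locally dependent indicators *)

Section SteinChen.
Variables (R : realType) (W J : finType) (m : W -> R).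
Variables (A : pred J) (B : J -> W -> bool) (dep : rel J) (p eta : R).
Local Notation E := (mean m).
Let X w := (\sum_(i | A i) B i w)%N.
Let V i w := (\sum_(j | A j && ~~ dep i j) B j w)%N.

Hypothesis m_ge0 : forall w, 0 <= m w.
Hypothesis m_total : \sum_w m w = 1.
Hypothesis p_ge0 : 0 <= p.
Hypothesis dep_refl : forall i, A i -> dep i i.
Hypothesis indep : forall (i : J) (g : nat -> R), A i ->
  E (fun w => (B i w)%:R * g (V i w)) = p * E (g \o V i).
Hypothesis corr : forall i j, A i -> A j -> dep i j ->
  p * p <= E (fun w => (B i w)%:R * (B j w)%:R).
Hypothesis near_sum : forall i, A i ->
  \sum_(j | A j && (dep i j && (j != i)))
    E (fun w => (B i w)%:R * (B j w)%:R) <= p * eta.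

Let mean1 (a : R) : E (fun=> a) = a.
Proof. by rewrite /mean -mulr_suml m_total mul1r. Qed.

Let mean_B i : A i -> E (fun w => (B i w)%:R) = p.
Proof.
move=> Ai; have := indep (fun=> 1) Ai.
by rewrite mean1 mulr1 => <-; apply: eq_mean => w; rewrite mulr1.
Qed.

Let Z i w := (\sum_(j | A j && (dep i j && (j != i))) B j w)%N.

Let X_split i w : A i -> X w = (B i w + Z i w + V i w)%N.
Proof.
move=> Ai; rewrite /X (bigID (dep i)) /=; congr addn.
rewrite (bigD1 i) /= ?Ai ?dep_refl //; congr addn.
by apply: eq_bigl => j; rewrite andbA.
Qed.

Let lip2 (f : nat -> R) : (forall j, `|f j| <= 1) ->
  forall a b : nat, `|f (a + b)%N - f b| <= 2 * a%:R.
Proof.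
move=> f1 [|a] b; first by rewrite add0n subrr normr0 mulr0.
apply: le_trans (ler_normB _ _) _.
have := f1 (a.+1 + b)%N; have := f1 b.
have : 1 <= a.+1%:R :> R by rewrite ler1n.
by lra.
Qed.

Let mean_Z i : A i -> E (fun w => (B i w)%:R * (Z i w)%:R) <= p * eta.
Proof.
move=> Ai; apply: le_trans (near_sum Ai); rewrite -mean_sum le_eqVlt.
apply/orP; left; apply/eqP/eq_mean => w.
by rewrite natr_sum mulr_sumr.
Qed.

(** Positive correlation, [corr], lets the single bound [near_sum] also control the products of the
    means over dependent pairs. *)
Let p_mean_Z i : A i -> p * E (fun w => (Z i w)%:R) <= p * eta.
Proof.
move=> Ai; apply: le_trans (near_sum Ai).
under eq_mean do rewrite natr_sum.
rewrite mean_sum mulr_sumr; apply: ler_sum => j /and3P[Aj dij _].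
by rewrite mean_B // corr.
Qed.

(** Both expectations are compared with that of [f (V i + 1)], where [V i] is independent of [B i].
    The arguments differ by [B i + Z i] in the first one and, when [B i] holds, by [Z i] in the
    second one. *)
Let stein_term (f : nat -> R) (i : J) : (forall j, `|f j| <= 1) -> A i ->
  `|p * E (fun w => f (X w).+1) - E (fun w => (B i w)%:R * f (X w))|
  <= 2 * p * (p + 2 * eta).
Proof.
move=> f1 Ai.
have -> : p * E (fun w => f (X w).+1) - E (fun w => (B i w)%:R * f (X w)) =
   p * E (fun w => f (X w).+1 - f (V i w).+1) +
   E (fun w => (B i w)%:R * f (V i w).+1 - (B i w)%:R * f (X w)).
  by rewrite !meanB (indep (fun j => f j.+1)) //= /comp; ring.
apply: le_trans (ler_normD _ _) _.
have h1 : `|E (fun w => f (X w).+1 - f (V i w).+1)| <=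
    2 * (p + E (fun w => (Z i w)%:R)).
  rewrite -(mean_B Ai) -meanD -meanZ; apply: mean_norm => // w.
  by rewrite (X_split _ Ai) -natrD -addnS lip2.
have h2 : `|E (fun w => (B i w)%:R * f (V i w).+1 - (B i w)%:R * f (X w))| <=
    2 * E (fun w => (B i w)%:R * (Z i w)%:R).
  rewrite -meanZ; apply: mean_norm => // w; rewrite (X_split _ Ai) distrC.
  case: (B i w); last by rewrite !mul0r subrr normr0 mulr0.
  by rewrite !mul1r add1n addSn -addnS lip2.
have := mean_Z Ai; have := p_mean_Z Ai; rewrite normrM (ger0_norm p_ge0).
have : p * `|E (fun w => f (X w).+1 - f (V i w).+1)| <=
    p * (2 * (p + E (fun w => (Z i w)%:R))) by rewrite ler_wpM2l.
by move: h2; nra.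
Qed.

(** Stein's equation at [X] writes the difference as the mean of [c f (X + 1) - X f (X)]. Replacing
    [c] by [#|A| p] costs the first error term, and splitting [X f (X)] into the sum of the
    [B i f (X)] leaves one [stein_term] for each [i]. *)
Lemma stein_chen (c : R) : 0 < c ->
  `|\sum_(w | X w == 1%N) m w - c * expR (- c)| <=
  `|c - #|A|%:R * p| + #|A|%:R * (2 * p * (p + 2 * eta)).
Proof.
move=> c0; set f := stein_sol c.
have f1 : forall j, `|f j| <= 1 by exact: stein_sol_le1.
have -> : \sum_(w | X w == 1%N) m w - c * expR (- c) =
   (c - #|A|%:R * p) * E (fun w => f (X w).+1) +
   \sum_(i | A i)
     (p * E (fun w => f (X w).+1) - E (fun w => (B i w)%:R * f (X w))).
  rewrite sumrB sumr_const -mulr_natl -mean_sum.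
  rewrite -mean_indic -[c * expR _]mean1 -meanB.
  under eq_mean do rewrite -stein_solE //.
  rewrite meanB meanZ.
  have -> : E (fun w => \sum_(i | A i) (B i w)%:R * f (X w)) =
      E (fun w => (X w)%:R * f (X w)).
    by apply: eq_mean => w; rewrite -mulr_suml -natr_sum.
  by rewrite -/f; ring.
apply: le_trans (ler_normD _ _) _; apply: lerD.
  rewrite normrM ler_piMr // -[leRHS]mean1; exact: mean_norm.
apply: le_trans (ler_norm_sum _ _ _) _.
rewrite mulr_natl -sumr_const; apply: ler_sum => i Ai; exact: stein_term.
Qed.

End SteinChen.

(** * Independence of the edges of the random graph *)

Section EdgeIndependence.
Variables (R : realType) (T : finType) (q : R).
Local Notation E := (mean (@er_mass R T q)).

(** Independence is expressed by symmetry: a function does not depend on the edge [e] when flipping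
    [e] leaves it invariant. Restricting to [vertex_pairs] makes the result a graph for every
    [e]. *)
Definition toggle_edges (e : {set T}) (G : sgraph T) : {set {set T}} :=
  [set x in vertex_pairs T | (x \in edges G) (+) (x == e)]%SET.

Lemma toggle_edges_sub (e : {set T}) (G : sgraph T) :
  toggle_edges e G \subset vertex_pairs T.
Proof. by apply/fintype.subsetP => x; rewrite inE => /andP[]. Qed.

Definition toggle (e : {set T}) (G : sgraph T) : sgraph T :=
  SGraph (toggle_edges_sub e G).

Lemma sgraph_edges_pairs (G : sgraph T) (x : {set T}) :
  x \in edges G -> x \in vertex_pairs T.
Proof. exact: (fintype.subsetP (edges_sub G)). Qed.

Lemma in_toggle (e x : {set T}) (G : sgraph T) : e \in vertex_pairs T ->
  (x \in edges (toggle e G)) = (x \in edges G) (+) (x == e).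
Proof.
move=> eV; rewrite inE; have [->|_] := eqVneq x e; first by rewrite eV.
rewrite addbF; case: (boolP (x \in edges G)) => [/sgraph_edges_pairs ->|] //.
by rewrite andbF.
Qed.

Lemma toggleK (e : {set T}) : e \in vertex_pairs T -> involutive (toggle e).
Proof.
move=> eV G; apply/val_inj/finset.setP => x.
by rewrite !in_toggle // -addbA addbb addbF.
Qed.

Lemma er_mass_toggle (e : {set T}) (G : sgraph T) :
  e \in vertex_pairs T -> e \in edges G ->
  (1 - q) * er_mass q G = q * er_mass q (toggle e G).
Proof.
move=> eV eG; rewrite /er_mass !(bigD1 e eV) /= in_toggle // eG eqxx /=.
rewrite mulrCA; congr (_ * (_ * _)); apply: eq_bigr => x /andP[_ /negPf xe].
by rewrite in_toggle // xe addbF.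
Qed.

Lemma mean_edge (e : {set T}) (g : sgraph T -> R) : e \in vertex_pairs T ->
  (forall G, g (toggle e G) = g G) ->
  E (fun G => (e \in edges G)%:R * g G) = q * E g.
Proof.
move=> eV ge.
have {2}-> : g =
    fun G => (e \in edges G)%:R * g G + (e \notin edges G)%:R * g G.
  by apply/funext => G; case: (e \in _); rewrite ?mul0r mul1r ?addr0 ?add0r.
rewrite meanD.
(* It remains to match the part of [E g] without [e], weighted by [q], with the part containing [e],
   weighted by [1 - q]; pairing each graph with its flip does this. *)
have -> : q * (E (fun G => (e \in edges G)%:R * g G) +
               E (fun G => (e \notin edges G)%:R * g G)) =
    q * E (fun G => (e \in edges G)%:R * g G) +
    (1 - q) * E (fun G => (e \in edges G)%:R * g G).
  rewrite mulrDr; congr (_ + _).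
  rewrite /mean (reindex_inj (inv_inj (toggleK eV))) !mulr_sumr.
  apply: eq_bigr => G _; rewrite in_toggle // eqxx ge.
  case: (boolP (e \in edges G)) => eG; last by rewrite !mul0r !mulr0.
  by rewrite !mul1r !mulrA (er_mass_toggle eV eG).
by rewrite -mulrDl subrKC mul1r.
Qed.

Lemma mean_all_edges (s : seq {set T}) (g : sgraph T -> R) :
  uniq s -> {subset s <= vertex_pairs T} ->
  (forall e, e \in s -> forall G, g (toggle e G) = g G) ->
  E (fun G => (all (mem (edges G)) s)%:R * g G) = q ^+ size s * E g.
Proof.
elim: s => [|e s IH] /=.
  by move=> _ _ _; rewrite mul1r; under eq_mean do rewrite mul1r.
move=> /andP[es us] sub ge.
have eV : e \in vertex_pairs T by apply: sub; rewrite mem_head.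
under eq_mean do rewrite -mulnb natrM -mulrA.
rewrite mean_edge //; last first.
  move=> G; rewrite ge ?mem_head //; congr (_%:R * _); congr (nat_of_bool _).
  apply: eq_in_all => x xs /=; rewrite in_toggle //.
  by case: (eqVneq x e) es => [<-|_ _]; rewrite ?xs ?addbF.
rewrite IH // ?exprS ?mulrA // => x xs; first by apply: sub; rewrite inE xs orbT.
by move=> G; rewrite ge // inE xs orbT.
Qed.

(** Expanding the product of the factors [F x + F' x = 1] over all sets [x] gives a sum over all
    families of sets. Off [vertex_pairs] the values 0 and 1 kill every family that is not the edge
    set of a graph. *)
Lemma er_mass_total : \sum_G @er_mass R T q G = 1.
Proof.
pose F (x : {set T}) := if x \in vertex_pairs T then q else 0.
pose F' (x : {set T}) := if x \in vertex_pairs T then 1 - q else 1.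
have <- : \prod_x (F x + F' x) = 1.
  by apply: big1 => x _; rewrite /F /F'; case: ifP => _; rewrite ?subrKC ?add0r.
rewrite bigA_distr /=.
rewrite (bigID (fun J : {set {set T}} => J \subset vertex_pairs T)).
rewrite /= [X in _ = _ + X]big1 ?addr0; last first.
  move=> J /fintype.subsetPn[x xJ xV].
  by rewrite (bigD1 x) //= xJ /F (negPf xV) mul0r.
have set0V : (finset.set0 : {set {set T}}) \subset vertex_pairs T.
  by rewrite finset.sub0set.
rewrite (reindex_onto (@edges T) (insubd (SGraph set0V))) /=; last first.
  by move=> J JV; exact: (insubdK (SGraph set0V) JV).
apply: eq_big => [G|G _].
  by rewrite edges_sub; apply/esym/eqP; exact: (valKd (SGraph set0V)).
rewrite /er_mass big_mkcond; apply: eq_bigr => x _; rewrite /F /F'.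
case: (boolP (x \in edges G)) => [/sgraph_edges_pairs ->|] //.
Qed.

Lemma er_mass_ge0 (G : sgraph T) : 0 <= q <= 1 -> 0 <= er_mass q G.
Proof.
by move=> /andP[q0 q1]; apply: prodr_ge0 => x _; case: ifP; rewrite ?subr_ge0.
Qed.

End EdgeIndependence.

(** * Edges of a simple path and their degrees *)

Section PathEdges.
Variable T : finType.
Implicit Types (u v x y : T) (s t : seq T) (G : sgraph T).

Definition pedges u s : seq {set T} := pairmap (fun x y => [set x; y]%SET) u s.

Lemma path_adjE G u s : path (adj G) u s = all (mem (edges G)) (pedges u s).
Proof. by elim: s u => //= x s IH u; rewrite IH. Qed.

Lemma mem_pedges u s e x : e \in pedges u s -> x \in e -> x \in u :: s.
Proof.
elim: s u => //= y s IH u; rewrite inE => /orP[/eqP ->|es xe].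
  by rewrite !inE => /orP[] ->; rewrite ?orbT.
by rewrite inE (IH y) ?orbT.
Qed.

Lemma uniq_pedges u s : uniq (u :: s) -> uniq (pedges u s).
Proof.
elim: s u => //= y s IH u /and3P[us ys uns].
rewrite IH /= ?ys ?uns // andbT; apply/negP => /mem_pedges -/(_ u).
by rewrite !inE eqxx => /(_ isT); rewrite -in_cons (negPf us).
Qed.

Lemma pedges_pairs u s : uniq (u :: s) -> {subset pedges u s <= vertex_pairs T}.
Proof.
elim: s u => //= y s IH u /and3P[us ys uns] e; rewrite inE => /orP[/eqP ->|es].
  by rewrite inE cards2; move: us; rewrite inE negb_or => /andP[->].
by apply: (IH y) => //=; rewrite ys.
Qed.

Lemma set2_inj x y y' : [set x; y]%SET = [set x; y']%SET -> y = y'.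
Proof.
move=> e; have /finset.setP/(_ y) := e.
rewrite !inE eqxx orbT => /esym /orP[/eqP yx|/eqP //].
by have /finset.setP/(_ y') := e; rewrite !inE eqxx orbT yx orbb => /eqP ->.
Qed.

(** The start [u] lies on only one edge of each simple path, so both paths take the same first edge,
    and it does not occur again further on; induction does the rest. *)
Lemma pedges_sub_eq u s t : uniq (u :: s) -> uniq (u :: t) ->
  size s = size t -> {subset pedges u t <= pedges u s} -> t = s.
Proof.
elim: s u t => [|y s IH] u [|z t] //= /andP[us uns] /andP[ut unt] [sz] sub.
have zy : z = y.
  have := sub _ (mem_head _ _); rewrite inE => /orP[/eqP/set2_inj //|].
  move=> /mem_pedges -/(_ u); rewrite !inE eqxx => /(_ isT).
  by rewrite -in_cons (negPf us).
rewrite zy in ut unt sub *; congr cons; apply: (IH y) => // e et.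
have := sub e; rewrite !inE et orbT => /(_ isT) /orP[/eqP eu|//].
have : u \in y :: t by apply: (mem_pedges et); rewrite eu !inE eqxx.
by rewrite (negPf ut).
Qed.

Lemma pedges_deg_head u s : uniq (u :: s) ->
  (#|[set z | [set u; z] \in pedges u s]%SET| <= 1)%N.
Proof.
case: s => [|y s] /=; first by rewrite (eq_card0 (A := _)) // => z; rewrite !inE.
move=> /andP[us _]; rewrite -(cards1 y); apply: subset_leq_card.
apply/fintype.subsetP => z; rewrite !inE => /orP[/eqP/set2_inj -> //|].
move=> /mem_pedges -/(_ u); rewrite !inE eqxx => /(_ isT).
by rewrite -in_cons (negPf us).
Qed.

Lemma pedges_deg u s y : uniq (u :: s) ->
  (#|[set z | [set y; z] \in pedges u s]%SET| <= 2)%N.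
Proof.
elim: s u => [|x s IH] u uns.
  by rewrite (eq_card0 (A := _)) // => z; rewrite !inE.
have [->|yu] := eqVneq y u; first exact: leq_trans (pedges_deg_head uns) _.
have unx : uniq (x :: s) by move: uns => /= /andP[].
have [->|yx] := eqVneq y x.
  apply: (@leq_trans #|(u |: [set z | [set x; z] \in pedges x s])%SET|).
    apply: subset_leq_card; apply/fintype.subsetP => z; rewrite !inE.
    rewrite (finset.setUC [set u]%SET).
    by move=> /orP[/eqP/set2_inj ->|->]; rewrite ?eqxx ?orbT.
  apply: leq_trans (leq_card_setU _ _) _; rewrite cards1.
  by rewrite add1n ltnS pedges_deg_head.
apply: leq_trans (IH _ unx); apply: subset_leq_card; apply/fintype.subsetP => z.
rewrite !inE => /orP[/eqP/finset.setP/(_ y)|//].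
by rewrite !inE eqxx (negPf yu) (negPf yx).
Qed.

(** Of the at most two path edges at [y], the arrival from [x] uses one. This is why a shared edge
    following a shared edge is forced. *)
Lemma pedges_deg_in u s x y : uniq (u :: s) -> [set x; y]%SET \in pedges u s ->
  (#|[set z | z != x & [set y; z] \in pedges u s]%SET| <= 1)%N.
Proof.
move=> uns; rewrite finset.setUC => xs; have := pedges_deg y uns.
rewrite (cardsD1 x) inE xs add1n ltnS; apply: leq_trans.
by rewrite leq_eqVlt; apply/orP; left; apply/eqP/eq_card => z; rewrite !inE.
Qed.

End PathEdges.

(** * Recursive bound on the weight of paths sharing edges with a fixed path *)

Lemma sum_tupleS (R : realType) (T : finType) (k : nat) (f : seq T -> R) :
  \sum_(t : k.+1.-tuple T) f t = \sum_z \sum_(t : k.-tuple T) f (z :: t).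
Proof.
rewrite pair_bigA /=.
rewrite (reindex (fun p : T * k.-tuple T => [tuple of p.1 :: p.2])) //=.
exists (fun t => (thead t, [tuple of behead t])) => [[z t] _|t _] /=.
  by congr pair; apply: val_inj.
by rewrite [RHS]tuple_eta.
Qed.

Section OverlapRecursion.
Variables (R : realType) (T : finType) (q : R) (v : T).
Variables (sh : rel T) (VP : {set T}).

(* [overlap k a b x y] bounds the total weight of the simple paths that run from
   [y] to [v] through [k] intermediate vertices after arriving from [x], an edge
   weighing 1 if it is shared (satisfies [sh]) and [q] otherwise; the flag [a]
   (resp. [b]) keeps the paths with a shared (resp. unshared) edge only.
   Simplicity is relaxed to the absence of immediate backtracking. *)
Fixpoint overlap (k : nat) (a b : bool) (x y : T) : R :=
  match k with
  | 0 => if sh y v then (~~ b)%:R else (~~ a)%:R * q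
  | k'.+1 => \sum_(z | z != x)
      if sh y z then overlap k' false b y z else q * overlap k' a false y z
  end.

Local Notation F := overlap.
Local Notation m := (#|VP|%:R : R).
Local Notation n := (#|T|%:R : R).
Local Notation N := (n * q).
Local Notation M := (m * q).

Hypothesis q_ge0 : 0 <= q.
Hypothesis sh_VP : forall x y, sh x y -> x \in VP.
Hypothesis sh_deg : forall y, (#|[set z | sh y z]%SET| <= 2)%N.
Hypothesis sh_deg_in : forall x y, sh x y ->
  (#|[set z | z != x & sh y z]%SET| <= 1)%N.
Hypothesis N_ge4 : 4 <= N.
Hypothesis m2q_le : 12 * m ^+ 2 * q <= 1.
Hypothesis VP_gt0 : (0 < #|VP|)%N.

Lemma overlap_le k a b x y : F k a b x y <= F k false false x y.
Proof.
elim: k a b x y => [|k IH] a b x y /=.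
  case: ifP => _; last by rewrite ler_wpM2r // ler_nat; case: a.
  by rewrite ler_nat; case: b.
by apply: ler_sum => z _; case: ifP => _; rewrite ?ler_wpM2l.
Qed.

(** Shared edges offer at most [D] continuations worth [al] each. Of the unshared ones, at most [n]
    lead off [VP], worth [o], and at most [m] lead into [VP], worth [p]; the factor [q] turns these
    counts into [N] and [M]. *)
Lemma overlap_step (D : nat) (x y : T) (A C : T -> R) (al o p : R) :
  0 <= al -> 0 <= o -> 0 <= p ->
  (#|[set z | z != x & sh y z]%SET| <= D)%N ->
  (forall z, sh y z -> A z <= al) ->
  (forall z, z \notin VP -> C z <= o) -> (forall z, C z <= p) ->
  \sum_(z | z != x) (if sh y z then A z else q * C z) <=
  D%:R * al + (N * o + M * p).
Proof.
move=> al0 o0 p0 hD hA ho hp; rewrite (bigID (sh y)) /=; apply: lerD.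
  apply: (@le_trans _ _ (\sum_(z | (z != x) && sh y z) al)).
    by apply: ler_sum => z /andP[_ yz]; rewrite yz hA.
  rewrite sumr_const -[al *+ _]mulr_natl ler_wpM2r // ler_nat.
  by apply: leq_trans hD; rewrite cardsE.
apply: (@le_trans _ _ (\sum_z (q * o + (if z \in VP then q * p else 0)))).
  rewrite big_mkcond /=; apply: ler_sum => z _.
  case: ifPn => [/andP[_ /negPf ->]|_].
    case: ifPn => zV; last by rewrite addr0 ler_wpM2l // ho.
    by rewrite ler_wpDl ?mulr_ge0 // ler_wpM2l.
  by case: ifP => _; rewrite addr_ge0 ?mulr_ge0.
rewrite big_split /= sumr_const -big_mkcond /= sumr_const.
rewrite -[(q * o) *+ _]mulr_natl -[(q * p) *+ _]mulr_natl.
by rewrite !mulrA.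
Qed.

Let m_ge1 : 1 <= m. Proof. by rewrite ler1n. Qed.

Let M_ge0 : 0 <= M. Proof. by rewrite mulr_ge0. Qed.

Let M_le (k : nat) : (k <= #|VP|)%N -> k%:R * (12 * M) <= 1.
Proof.
move=> km; apply: le_trans m2q_le.
have : k%:R <= m by rewrite ler_nat.
by move: M_ge0; nra.
Qed.

Let M12 : 12 * M <= 1.
Proof. by have := M_le VP_gt0; rewrite mul1r. Qed.

Let Nk_ge1 k : 1 <= N ^+ k.
Proof. by apply: exprn_ege1; move: N_ge4; lra. Qed.

Let deg_out y (x : T) : y \notin VP -> (#|[set z | z != x & sh y z]%SET| <= 0)%N.
Proof.
move=> yV; rewrite (eq_card0 (A := _)) // => z; rewrite !inE.
by apply/negP => /andP[_ /sh_VP]; rewrite (negPf yV).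
Qed.

Let deg_any x y : (#|[set z | z != x & sh y z]%SET| <= 2)%N.
Proof.
apply: leq_trans (sh_deg y); apply: subset_leq_card; apply/fintype.subsetP => z.
by rewrite !inE => /andP[].
Qed.

Let sh_out y z : y \notin VP -> sh y z = false.
Proof. by move=> yV; apply/negP => /sh_VP; rewrite (negPf yV). Qed.

(* The main term is M N^k, the weight of reaching a vertex of VP by unshared
   edges; the terms in k (12 M) account for intermediate visits of VP. *)
Lemma overlap_bounds k : (k <= #|VP|)%N ->
  [/\ forall x y, y \notin VP ->
        F k false false x y <= M * N ^+ k * (3 + k%:R * (12 * M)) - 2 * M,
      forall x y, F k false false x y <= 2 + 12 * (M * N ^+ k),
      forall x y, sh x y -> F k false false x y <= 1 + 12 * (M * N ^+ k),
      forall x y, sh x y -> F k false true x y <= 12 * (M * N ^+ k) &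
      forall x y, y \notin VP -> F k true false x y <=
        (M * N ^+ k * (4 + k%:R * (12 * M)) - 4 * M) / N].
Proof.
have N1 : 1 <= N by move: N_ge4; lra.
have N0 : 0 < N by move: N1; lra.
elim: k => [_|k IH km].
  have qM : q <= M by rewrite ler_peMl.
  rewrite expr0 mul0r !addr0 !mulr1 /= !mul1r.
  have h1 x y : F 0 false false x y <= 1 + 12 * M.
    by rewrite /=; case: ifP => _; move: qM q_ge0 M12; lra.
  split=> [x y yV|x y|x y _|x y _|x y yV]; last 4 first.
  - by have := h1 x y; rewrite /= mul1r; lra.
  - by have := h1 x y; rewrite /= mul1r.
  - by case: ifP => _; move: M_ge0 qM; rewrite ?mulr0n; lra.
  - by rewrite sh_out // mul0r (mulrC _ 4) subrr mul0r.
  by rewrite sh_out //; lra.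
have [] := IH (ltnW km) => ho hp hb hH hK.
have := M_le (ltnW km); have := M_le km.
move: ho hp hb hH hK; move: (Nk_ge1 k); rewrite exprS.
set Q := N ^+ k => Q1 ho hp hb hH hK kM' kM.
pose Y := M * Q; have Y0 : 0 <= Y by rewrite mulr_ge0 //; lra.
have M0 := M_ge0.
have MY : M <= Y by rewrite ler_peMr.
have NY : 4 * Y <= N * Y by rewrite ler_wpM2r.
have MYM : M * Y * 12 <= Y by move: Y0 M12; nra.
have MY0 : 0 <= M * Y by rewrite mulr_ge0.
have NMY : M * Y <= N * (M * Y) by rewrite ler_peMl.
have N0W := ltW N0.
have NM : 4 * M <= N * M by rewrite ler_wpM2r.
have kMY0 : 0 <= k%:R * (12 * M) by rewrite !mulr_ge0.
pose e := k%:R * (12 * M).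
have eY : e * Y <= Y by rewrite ler_piMl.
have eY0 : 0 <= e * Y by rewrite mulr_ge0.
have NeY : N * (e * Y) <= N * Y by rewrite ler_wpM2l.
(* The subtracted [2 M] becomes [2 N M] after one step, which absorbs the constant 2 of the bound
   [hp], paid with a factor [M] on entering [VP]. *)
set o := M * Q * (3 + k%:R * (12 * M)) - 2 * M.
have oE : o = 3 * Y + e * Y - 2 * M by rewrite /o /e /Y; ring.
have o0 : 0 <= o by lra.
have p0 : 0 <= 2 + 12 * Y by lra.
have NoE : N * o = 3 * (N * Y) + N * (e * Y) - 2 * (N * M) by rewrite oE; ring.
(* Unshared continuations use up at most half of the allowance [12 N Y]; as [N >= 4], the other half
   covers the [2 * 12 Y] of two shared ones. *)
have g_le : N * o + M * (2 + 12 * Y) <= 6 * (N * Y) by rewrite NoE; lra.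
have b0 : 0 <= 1 + 12 * Y by lra.
have Y12 : 0 <= 12 * Y by lra.
have E1 : M * (N * Q) = N * Y by rewrite /Y; ring.
split=> [x y yV|x y|x y xy|x y xy|x y yV] /=; rewrite E1.
- apply: le_trans (overlap_step b0 o0 p0 (deg_out x yV) _ (ho y) (hp y)) _.
    by move=> z; exact: hb.
  have -> : N * Y * (3 + k.+1%:R * (12 * M)) =
      3 * (N * Y) + N * (e * Y) + 12 * (N * (M * Y)).
    by rewrite /e -natr1; ring.
  by lra.
- apply: le_trans (overlap_step b0 o0 p0 (deg_any x y) _ (ho y) (hp y)) _.
    by move=> z; exact: hb.
  by lra.
- apply: le_trans (overlap_step b0 o0 p0 (sh_deg_in xy) _ (ho y) (hp y)) _.
    by move=> z; exact: hb.
  by lra.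
- apply: le_trans (overlap_step Y12 o0 p0 (sh_deg_in xy) _ (ho y) (hp y)) _.
    by move=> z; exact: hH.
  by lra.
(* A shared edge still to come removes one free choice of a vertex, hence the division by [N]. *)
- set o' := (M * Q * (4 + k%:R * (12 * M)) - 4 * M) / N in hK.
  have o'E : N * o' = 4 * Y + e * Y - 4 * M.
    by rewrite /o' mulrC divfK ?gt_eqF // /e /Y; ring.
  have o'0 : 0 <= o' by rewrite -(pmulr_rge0 _ N0) o'E; lra.
  apply: le_trans (overlap_step b0 o'0 p0 (deg_out x yV) _ (hK y) _) _.
  + by move=> z; exact: hb.
  + by move=> z; apply: le_trans (hp y z); exact: overlap_le.
  rewrite ler_pdivlMr // o'E mul0r add0r.
  have -> : (4 * Y + e * Y - 4 * M + M * (2 + 12 * Y)) * N =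
     4 * (N * Y) + N * (e * Y) - 2 * (N * M) + 12 * (N * (M * Y)) by ring.
  have -> : N * Y * (4 + k.+1%:R * (12 * M)) =
      4 * (N * Y) + N * (e * Y) + 12 * (N * (M * Y)).
    by rewrite /e -natr1; ring.
  by lra.
Qed.

(** The first edge is either shared, with at most two choices and an unshared edge still to come, or
    unshared, with a shared edge still to come. With [Y = M N^k], the former contributes at most
    [2 * 12 Y] and the latter at most [6 Y]. *)
Lemma overlap_proper k x y : (k < #|VP|)%N ->
  F k.+1 true true x y <= 30 * (M * N ^+ k).
Proof.
move=> /ltnW km; have [_ hp hb hH hK] := overlap_bounds km.
have := M_le km; move: hp hb hH hK (Nk_ge1 k).
set Q := N ^+ k => hp hb hH hK Q1 kM.
have N1 : 1 <= N by move: N_ge4; lra.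
have N0 : 0 < N by move: N1; lra.
pose Y := M * Q; have Y0 : 0 <= Y by rewrite mulr_ge0 //; lra.
have M0 := M_ge0.
have MY : M <= Y by rewrite ler_peMr.
have MYM : M * Y * 12 <= Y by move: Y0 M12; nra.
pose e := k%:R * (12 * M).
have e0 : 0 <= e by rewrite !mulr_ge0.
have eY : e * Y <= Y by rewrite ler_piMl.
have eY0 : 0 <= e * Y by rewrite mulr_ge0.
set o := (M * Q * (4 + k%:R * (12 * M)) - 4 * M) / N in hK.
have oE : N * o = 4 * Y + e * Y - 4 * M.
  by rewrite /o mulrC divfK ?gt_eqF // /e /Y; ring.
have o0 : 0 <= o by rewrite -(pmulr_rge0 _ N0) oE; lra.
have p0 : 0 <= 2 + 12 * Y by lra.
have Y12 : 0 <= 12 * Y by lra.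
apply: le_trans (overlap_step Y12 o0 p0 (deg_any x y) _ (hK y) _) _.
- by move=> z; exact: hH.
- by move=> z; apply: le_trans (hp y z); exact: overlap_le.
by rewrite -/Y; lra.
Qed.

End OverlapRecursion.

(** The first edge discharges the flag [a] if it is shared and the flag [b] if it is not, as in the
    recursion. The condition [x \notin t] carries the absence of backtracking through the
    induction. *)
Lemma sum_overlap_le (R : realType) (T : finType) (q : R) (v : T)
    (E : seq {set T}) (k : nat) (a b : bool) (x y : T) : 0 <= q ->
  \sum_(t : k.-tuple T | [&& uniq (y :: t), x \notin t,
      a ==> has (mem E) (pedges y (rcons t v)) &
      b ==> ~~ all (mem E) (pedges y (rcons t v))])
    \prod_(e <- pedges y (rcons t v)) (if e \in E then 1 else q) <=
  overlap q v (fun y z => [set y; z]%SET \in E) k a b x y.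
Proof.
move=> q0.
pose f a b x y (t : seq T) : R := if [&& uniq (y :: t), x \notin t,
      a ==> has (mem E) (pedges y (rcons t v)) &
      b ==> ~~ all (mem E) (pedges y (rcons t v))]
    then \prod_(e <- pedges y (rcons t v)) (if e \in E then 1 else q) else 0.
rewrite [leLHS](_ : _ = \sum_(t : k.-tuple T) f a b x y t); last first.
  by rewrite big_mkcond.
have f_ge0 a' b' x' y' t : 0 <= f a' b' x' y' t.
  by rewrite /f; case: ifP => // _; apply: prodr_ge0 => e _; case: ifP.
elim: k a b x y => [|k IH] a b x y.
  rewrite (bigD1 [tuple]) //= big1 ?addr0; last first.
    by move=> t /eqP tn; case: tn; exact: tuple0.
  rewrite /f /= big_seq1 orbF andbT; case: (_ \in E).
    by rewrite implybT /=; case: b.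
  by rewrite implybT andbT; case: a; rewrite ?mul1r ?mul0r.
rewrite (sum_tupleS _ (f a b x y)) /= [leRHS]big_mkcond; apply: ler_sum => z _.
have fE (t : k.-tuple T) : f a b x y (z :: t) <=
    if z != x then
      if [set y; z]%SET \in E then f false b y z t else q * f a false y z t
    else 0.
  rewrite /f /= big_cons !in_cons !negb_or.
  have [->|zx] /= := eqVneq z x; first by rewrite andbF.
  set g := pedges z (rcons t v).
  have pr0 : 0 <= \prod_(e <- g) (if e \in E then 1 else q).
    by apply: prodr_ge0 => e _; case: ifP.
  case: (boolP ([set y; z]%SET \in E)) => yz /=.
    rewrite mul1r; case: ifP => [/and4P[/and3P[/andP[_ ->] -> ->] _ _ ->] //|_].
    by case: ifP.
  case: ifP => [/and4P[/and3P[/andP[_ ->] -> ->] _ -> _] //|_].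
  by rewrite mulr_ge0 //; case: ifP.
apply: (le_trans (ler_sum _ (fun t _ => fE t))).
case: ifP => _; last by rewrite big1.
by case: ifP => _; rewrite -?mulr_sumr ?ler_wpM2l.
Qed.

(** * Poisson approximation for the number of open paths of a given length *)

Section TwoPointPaths.
Variables (R : realType) (T : finType) (q : R) (u v : T) (K : nat).
Hypothesis uv : u != v.
Hypothesis q_itv : 0 <= q <= 1.
Local Notation N := (#|T|%:R * q).

(* The tuple of intermediate vertices encodes the path u :: rcons t v. *)
Definition inner_path : pred (K.-tuple T) := fun t => uniq (u :: rcons t v).

Definition open_path (t : K.-tuple T) (G : sgraph T) : bool :=
  path (adj G) u (rcons t v).

Definition share_edge : rel (K.-tuple T) := fun s t =>
  has (mem (pedges u (rcons s v))) (pedges u (rcons t v)).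

Lemma size_inner_pedges (t : K.-tuple T) : size (pedges u (rcons t v)) = K.+1.
Proof. by rewrite size_pairmap size_rcons size_tuple. Qed.

Lemma card_inner_path : #|inner_path| = ((#|T| - 2) ^_ K)%N.
Proof.
have -> : (#|T| - 2)%N = #|[pred x | x \notin [:: u; v]]|.
  have := cardC [in [:: u; v]]; rewrite (card_uniqP _) /= ?inE ?uv // => <-.
  by rewrite addKn; apply: eq_card => x; rewrite !inE.
rewrite -card_uniq_tuples; apply: eq_card => t.
have -> : (t \in inner_path) = uniq (u :: rcons t v) by [].
rewrite cons_uniq mem_rcons in_cons negb_or uv rcons_uniq [RHS]inE.
have -> : all [pred x | x \notin [:: u; v]] t = (u \notin t) && (v \notin t).
  have -> : all [pred x | x \notin [:: u; v]] t = ~~ has (mem [:: u; v]) t.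
    by rewrite -all_predC.
  by rewrite has_sym /= orbF negb_or.
by rewrite andbA.
Qed.

(** Both paths are open exactly when the edges of [s] and the edges of [t] not in [s] are present;
    these are distinct, so each shared edge is paid for once. *)
Lemma mean_open_pair (s t : K.-tuple T) : inner_path s -> inner_path t ->
  mean (er_mass q) (fun G => (open_path s G)%:R * (open_path t G)%:R) =
  q ^+ K.+1 * \prod_(e <- pedges u (rcons t v))
    (if e \in pedges u (rcons s v) then 1 else q).
Proof.
move=> us ut; set es := pedges u (rcons s v); set et := pedges u (rcons t v).
transitivity (mean (@er_mass R T q) (fun G =>
    (all (mem (edges G)) (es ++ [seq e <- et | e \notin es]))%:R * 1)).
  apply: eq_mean => G; rewrite mulr1 -natrM mulnb; congr (nat_of_bool _)%:R.
  rewrite /open_path !path_adjE -/es -/et all_cat.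
  case: (boolP (all _ es)) => //= /allP es_G; rewrite all_filter.
  apply: eq_in_all => e _ /=; case: (boolP (e \in es)) => // /es_G.
  by rewrite /= => ->.
rewrite mean_all_edges //.
- rewrite size_cat exprD size_inner_pedges -mulrA; congr (_ * _).
  rewrite /mean -mulr_suml er_mass_total !mulr1 size_filter.
  elim: et => [|e et IH] /=; first by rewrite big_nil expr0.
  by rewrite big_cons exprD IH; case: (e \in es) => /=; rewrite ?expr0 ?expr1.
- rewrite cat_uniq filter_uniq ?uniq_pedges // andbT /=.
  by apply/hasPn => e; rewrite mem_filter => /andP[].
- move=> e; rewrite mem_cat => /orP[/pedges_pairs -> //|].
  by rewrite mem_filter => /andP[_ /pedges_pairs ->].
Qed.

(** A path [t] other than [s] has an unshared edge by [pedges_sub_eq], so both flags of [overlap]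
    may be set. [VP] consists of the [K + 2] vertices of the path of [s]. *)
Lemma overlap_sum_le (s : K.-tuple T) : inner_path s ->
  4 <= N -> 12 * K.+2%:R ^+ 2 * q <= 1 ->
  \sum_(t | inner_path t && (share_edge s t && (t != s)))
    \prod_(e <- pedges u (rcons t v))
      (if e \in pedges u (rcons s v) then 1 else q) <=
  30 * (K.+2%:R * q * N ^+ K / N).
Proof.
move=> us N4 m2q; have [q0 q1] := andP q_itv; set es := pedges u (rcons s v).
have cVP : #|[set x in u :: rcons s v]%SET| = K.+2.
  by rewrite cardsE (card_uniqP us) /= size_rcons size_tuple.
(* No vertex precedes [u]; [u] itself takes that place, as a simple path does not return to it. *)
apply: (@le_trans _ _
    (overlap q v (fun y z => [set y; z]%SET \in es) K true true u u)).
  apply: le_trans (sum_overlap_le _ _ _ _ _ _ _ q0).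
  rewrite [leLHS]big_mkcond [leRHS]big_mkcond; apply: ler_sum => t _.
  case: ifP => [/and3P[ut sht ts]|_]; last first.
    by case: ifP => // _; apply: prodr_ge0 => e _; case: ifP.
  rewrite /= [X in if X then _ else _](_ : _ = true) //.
  have /and3P[ut' _ unt] : [&& u \notin t, v \notin t & uniq t].
    move: ut; rewrite /inner_path /= mem_rcons inE negb_or rcons_uniq.
    by move=> /andP[/andP[_ ->]].
  rewrite ut' unt /= -/es; apply/andP; split; first exact: sht.
  apply: contra ts => /allP sub.
  by have /rcons_inj [/val_inj ->] : rcons t v = rcons s v
    by apply: (pedges_sub_eq us ut); rewrite ?size_rcons ?size_tuple.
(* A single edge cannot be both shared and unshared, so for [K = 0] the recursion gives 0. *)
have [K0|K0] := posnP K.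
  rewrite K0 /=; case: ifP => _; rewrite ?mul0r.
    by rewrite mulr_ge0 // divr_ge0 ?mulr_ge0 ?exprn_ge0 ?mulr_ge0.
  by rewrite mulr_ge0 // divr_ge0 ?mulr_ge0 ?exprn_ge0 ?mulr_ge0.
rewrite -{1}(prednK K0).
apply: le_trans (@overlap_proper R T q v _ [set x in u :: rcons s v]%SET
    q0 _ _ _ N4 _ _ _ _ _ _) _ => //.
- move=> x y xy; rewrite inE; apply: (mem_pedges xy); by rewrite !inE eqxx.
- by move=> y; exact: pedges_deg.
- by move=> x y xy; exact: pedges_deg_in.
- by rewrite cVP.
- by rewrite cVP.
- by rewrite cVP prednK // ltnW.
have -> : N ^+ K = N ^+ K.-1 * N by rewrite -exprSr prednK.
by rewrite cVP (mulrA _ _ N) mulfK // gt_eqF //; lra.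
Qed.

(** Stein-Chen applies with [p = q^(K+1)], dependence meaning a common edge, and with [eta] the
    bound of [overlap_sum_le]. *)
Lemma path_count_poisson (c : R) : 0 < c ->
  4 <= N -> 12 * K.+2%:R ^+ 2 * q <= 1 ->
  `|\sum_(G | (\sum_(t | inner_path t) open_path t G)%N == 1%N) er_mass q G
    - c * expR (- c)| <=
  `|c - #|inner_path|%:R * q ^+ K.+1| + #|inner_path|%:R * (2 * q ^+ K.+1 *
     (q ^+ K.+1 + 2 * (30 * (K.+2%:R * q * N ^+ K / N)))).
Proof.
move=> c0 N4 m2q; have [q0 q1] := andP q_itv.
apply: (@stein_chen _ _ _ _ _ open_path share_edge) => //.
- by move=> G; exact: er_mass_ge0.
- exact: er_mass_total.
- by rewrite exprn_ge0.
- move=> t ut; rewrite /share_edge.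
  by case: (rcons t v) (size_rcons t v) => //= x s _; rewrite inE eqxx.
- move=> t g ut; rewrite -(size_inner_pedges t).
  under eq_mean do rewrite /open_path path_adjE.
  rewrite mean_all_edges ?uniq_pedges //; first exact: pedges_pairs.
  (* An edge of [t] lies on no path that is edge-disjoint from [t], so toggling it leaves the number
     of such open paths unchanged. *)
  move=> e et G; congr (g _); apply: eq_bigr => s /andP[us nst].
  congr (nat_of_bool _); rewrite /open_path !path_adjE; apply: eq_in_all => x xs.
  rewrite /= in_toggle ?(pedges_pairs ut et) //.
  have [xe|_] := eqVneq x e; last by rewrite addbF.
  by case/hasP: nst; exists x; rewrite //= xe.
(* Every factor of the product is 1 or [q], hence at least [q]: open paths are positively
   correlated. *)
- move=> s t us ut _; rewrite mean_open_pair // ler_wpM2l ?exprn_ge0 //.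
  rewrite -(size_inner_pedges t).
  elim: (pedges u _) => [|e es IH] /=; first by rewrite big_nil expr0.
  rewrite big_cons exprS; apply: ler_pM => //; first by rewrite exprn_ge0.
  by case: ifP.
- move=> s us.
  rewrite (eq_bigr (fun t : K.-tuple T =>
    q ^+ K.+1 * \prod_(e <- pedges u (rcons t v))
      (if e \in pedges u (rcons s v) then 1 else q))); last first.
    by move=> t /andP[ut _]; rewrite mean_open_pair.
  by rewrite -mulr_sumr ler_wpM2l ?exprn_ge0 // overlap_sum_le.
Qed.

Lemma mean_open (t : K.-tuple T) : inner_path t ->
  mean (er_mass q) (fun G => (open_path t G)%:R) = q ^+ K.+1.
Proof.
move=> ut; transitivity (mean (@er_mass R T q) (fun G =>
    (all (mem (edges G)) (pedges u (rcons t v)))%:R * 1)).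
  by apply: eq_mean => G; rewrite mulr1 /open_path path_adjE.
rewrite mean_all_edges ?uniq_pedges //; last exact: pedges_pairs.
rewrite size_inner_pedges.
by rewrite /mean -mulr_suml er_mass_total !mulr1.
Qed.

Lemma mean_open_sum_le :
  mean (er_mass q) (fun G => (\sum_(t | inner_path t) open_path t G)%:R) <=
  q * N ^+ K.
Proof.
have [q0 q1] := andP q_itv; under eq_mean do rewrite natr_sum.
rewrite mean_sum (eq_bigr (fun=> q ^+ K.+1)); last by move=> t; exact: mean_open.
rewrite sumr_const -[leLHS]mulr_natl exprS mulrCA ler_wpM2l // exprMn.
rewrite ler_wpM2r ?exprn_ge0 // -natrX ler_nat -(card_tuple K T).
exact: max_card.
Qed.

End TwoPointPaths.

(** * From path counts to the unique shortest path *)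

Section UniqueShortestPath.
Variables (R : realType) (T : finType) (u v : T).
Hypothesis uv : u != v.
Implicit Types (G : sgraph T) (K : nat).

Definition path_count K G : nat :=
  (\sum_(t : K.-tuple T | inner_path u v t) open_path u v t G)%N.

Let inner_open K G : pred (K.-tuple T) :=
  fun t => inner_path u v t && open_path u v t G.

Let path_countE K G : path_count K G = #|@inner_open K G|.
Proof.
rewrite -sum1_card /path_count big_mkcond [RHS]big_mkcond; apply: eq_bigr => t _.
by rewrite -topredE /= /inner_open; case: inner_path; case: open_path.
Qed.

Let inner_is_path K G (t : K.-tuple T) :
  inner_open G t -> is_path G u v (rcons t v).
Proof. by move=> /andP[ut ot]; split; rewrite ?last_rcons. Qed.

Let is_pathE G p : is_path G u v p ->
  exists K (t : K.-tuple T), p = rcons t v /\ inner_open G t.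
Proof.
case/lastP: p => [|p w]; first by case=> _ /= /eqP; rewrite (negPf uv).
case; rewrite last_rcons => pG wv un; rewrite wv in pG un *.
by exists (size p), (in_tuple p); rewrite /inner_open /inner_path /open_path un.
Qed.

Let count_lt_empty K G (p : seq T) : is_path G u v p ->
  (forall k, (k < K)%N -> path_count k G = 0%N) -> (K < size p)%N.
Proof.
move=> /is_pathE[k [t [-> tP]]] h; rewrite size_rcons size_tuple ltnS leqNgt.
apply/negP => /h; rewrite path_countE => /eqP; rewrite -leqn0 leqNgt => /negP[].
by apply/card_gt0P; exists t.
Qed.

Let rcons_tuple_inj K (s t : K.-tuple T) : rcons s v = rcons t v -> s = t.
Proof. by move=> /rcons_inj[/val_inj]. Qed.

Lemma unique_shortest_count K G :
  unique_shortest_path_of_length G u v K.+1 -> path_count K G = 1%N.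
Proof.
move=> [p [[[pp pmin] puniq] [szp]]].
have [k [t [pE tP]]] := is_pathE pp.
have kK : k = K by move: szp; rewrite pE size_rcons size_tuple => -[].
subst k; rewrite path_countE (@fintype.eq_card1 _ t) // => s.
rewrite -topredE /= inE; apply/idP/eqP => [sP|-> //].
apply: rcons_tuple_inj; rewrite -pE; apply/esym/puniq; split.
  exact: inner_is_path.
by move=> p' /pmin; rewrite szp size_rcons size_tuple.
Qed.

Lemma count_unique_shortest K G : path_count K G = 1%N ->
  (forall k, (k < K)%N -> path_count k G = 0%N) ->
  unique_shortest_path_of_length G u v K.+1.
Proof.
rewrite path_countE => /eqP/card1P[t tE] h.
have tP : inner_open G t by have := tE t; rewrite -topredE /= inE eqxx.
exists (rcons t v); split; last by rewrite size_rcons size_tuple.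
split.
  split; first exact: inner_is_path.
  by move=> p' /count_lt_empty -/(_ _ h); rewrite size_rcons size_tuple.
move=> p [pp pmin]; have := count_lt_empty pp h.
have := pmin _ (inner_is_path tP); rewrite size_rcons size_tuple => le1 le2.
have [k [s [pE sP]]] := is_pathE pp.
have kK : k = K by move: le1 le2; rewrite pE size_rcons size_tuple; lia.
subst k; rewrite pE; congr (rcons (tval _) _); apply/esym/eqP.
by have := tE s; rewrite -topredE /= inE sP.
Qed.

(** The two events differ only if there are exactly one path of length [K + 1] and also some shorter
    path; Markov's inequality bounds this by the expected number of shorter paths. *)
Lemma er_prob_unique_shortest (q : R) K : 0 <= q <= 1 ->
  `|er_prob q [set G | unique_shortest_path_of_length G u v K.+1] -
    \sum_(G | path_count K G == 1%N) er_mass q G| <=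
  \sum_(k < K) q * (#|T|%:R * q) ^+ k.
Proof.
move=> q01; rewrite /er_prob -[X in `|X - _|]mean_indic -[X in `|_ - X|]mean_indic.
rewrite -meanB.
have m0 G : 0 <= er_mass q G by exact: er_mass_ge0.
apply: (@le_trans _ _
    (mean (er_mass q) (fun G => \sum_(k < K) (path_count k G)%:R))).
  apply: mean_norm => // G.
  have sum0 : 0 <= \sum_(k < K) (path_count k G)%:R :> R by apply: sumr_ge0.
  have [GE|nE] := boolP (G \in _).
    by rewrite (unique_shortest_count (set_mem GE)) eqxx subrr normr0.
  rewrite sub0r normrN; case: eqP => [X1|_]; last by rewrite normr0.
  have [k] : exists k : 'I_K, path_count k G != 0%N.
    apply/existsP; apply: contraNT nE; rewrite negb_exists => /forallP h.
    apply/mem_set/(count_unique_shortest X1) => k kK.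
    by have := h (Ordinal kK); rewrite negbK => /eqP.
  rewrite -lt0n => Xk; rewrite normr1 (bigD1 k) //= ler_wpDr ?sumr_ge0 //.
  by rewrite ler1n.
rewrite mean_sum; apply: ler_sum => k _; exact: (mean_open_sum_le u v k q01).
Qed.

End UniqueShortestPath.

(** * Explicit error bound for the probability *)

Lemma ffact_ge (n K : nat) :
  (n ^ K.+1 <= n * (n - 2) ^_ K + K * (K + 2) * n ^ K)%N.
Proof.
(* Multiplying by [n - 2 - K] instead of [n] loses at most [K + 2], even with truncated subtraction,
   and [K (K + 2) + (K + 2) <= (K + 1) (K + 3)]. *)
elim: K => [|K IH]; first by rewrite expn1 ffactn0 muln1 mul0n addn0.
rewrite ffactnSr [(n ^ K.+2)%N]expnS.
have le1 : ((n - 2) ^_ K <= n ^ K)%N.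
  rewrite ffact_prod -[X in (n ^ X)%N](card_ord K) -prod_nat_const.
  by apply: leq_prod => i _; lia.
move: IH le1; rewrite [(n ^ K.+1)%N]expnS.
move: ((n - 2) ^_ K)%N (n ^ K)%N => L Q IH le1.
have h1 : (n * (n * Q) <= n * (n * L) + n * (K * (K + 2) * Q))%N.
  by rewrite -mulnDr leq_mul2l IH orbT.
have h2 : (n * (n * L) <= n * (L * (n - 2 - K)) + n * (L * (K + 2)))%N.
  by rewrite -mulnDr leq_mul2l -mulnDr mulnC leq_mul2l; lia.
have h3 : (n * (L * (K + 2)) <= n * (Q * (K + 2)))%N.
  by rewrite !leq_mul2l leq_mul2r le1 !orbT.
by apply: (leq_trans h1); nia.
Qed.

Lemma geometric_le (R : realType) (N : R) (K : nat) : 2 <= N ->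
  \sum_(k < K) N ^+ k <= 2 * (N ^+ K / N).
Proof.
move=> N2; have N0 : 0 < N by lra.
rewrite mulrA ler_pdivlMr //.
elim: K => [|K IH]; first by rewrite big_ord0 mul0r mulr_ge0.
rewrite big_ord_recr mulrDl exprSr /=.
have : 0 < N ^+ K by rewrite exprn_gt0.
by move: (N ^+ K) IH => Q; nra.
Qed.

Section PoissonError.
Variables (R : realType) (T : finType) (q c : R) (u v : T) (K : nat).
Local Notation N := (#|T|%:R * q).
Local Notation m := (K.+2%:R : R).
Local Notation L := (#|@inner_path T u v K|%:R : R).

(** [ffact_ge] gives a relative loss of [K (K + 2) / #|T|], which is at most [m^2 q] because
    [N >= 1] means [1 / #|T| <= q]. *)
Lemma expected_count_bounds : u != v -> 0 <= q -> 1 <= N ->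
  L * q ^+ K.+1 <= q * N ^+ K <= L * q ^+ K.+1 + m ^+ 2 * q * (q * N ^+ K).
Proof.
move=> uv q0 N1; have p0 : 0 <= q ^+ K by rewrite exprn_ge0.
have n0 : 0 < (#|T|%:R : R).
  by rewrite ltr0n; apply/card_gt0P; exists u.
have -> : q * N ^+ K = #|T|%:R ^+ K * q ^+ K.+1 by rewrite exprMn exprS; ring.
apply/andP; split.
  rewrite ler_wpM2r ?exprn_ge0 // -natrX ler_nat -(card_tuple K T).
  exact: max_card.
have := ffact_ge #|T| K; rewrite -(card_inner_path K uv) -(ler_nat R).
rewrite natrD !natrM !natrX exprS => hL.
have hL' : #|T|%:R * (#|T|%:R ^+ K * q ^+ K.+1) <=
    #|T|%:R * (L * q ^+ K.+1) + K%:R * (K + 2)%:R * (#|T|%:R ^+ K * q ^+ K.+1).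
  by rewrite !mulrA -mulrDl ler_wpM2r ?exprn_ge0.
set Q := #|T|%:R ^+ K * q ^+ K.+1 in hL' *.
have Q0 : 0 <= Q by rewrite mulr_ge0 ?exprn_ge0 // ltW.
rewrite -(ler_pM2l n0) mulrDr; apply: (le_trans hL'); rewrite lerD2l.
have -> : #|T|%:R * (m ^+ 2 * q * Q) = m ^+ 2 * (N * Q) by ring.
apply: ler_pM => //.
  by rewrite -natrM -natrX ler_nat; lia.
by rewrite ler_peMl.
Qed.

(** Relative to [q N^K], the shorter paths cost [2 / N], the repeated vertices excluded from the
    count cost [m^2 q], and Stein-Chen costs the last two terms, using [q^(K+1) <= q]. *)
Lemma er_prob_poisson_error : u != v -> 0 < c -> 0 <= q <= 1 ->
  4 <= N -> 12 * m ^+ 2 * q <= 1 ->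
  `|er_prob q [set G | unique_shortest_path_of_length G u v K.+1]
    - c * expR (- c)| <=
  `|c - q * N ^+ K| + q * N ^+ K *
    (2 / N + m ^+ 2 * q + 2 * q + 120 * (m / N) * (q * N ^+ K)).
Proof.
move=> uv c0 q01 N4 m2q; have [q0 q1] := andP q01.
have N1 : 1 <= N by lra.
have N0 : 0 < N by lra.
have h1 := @er_prob_unique_shortest R T u v uv q K q01.
have h2 := @path_count_poisson R T q u v K q01 c c0 N4 m2q.
have N2 : 2 <= N by lra.
have geo : \sum_(k < K) q * N ^+ k <= q * N ^+ K * (2 / N).
  have -> : q * N ^+ K * (2 / N) = q * (2 * (N ^+ K / N)) by ring.
  by rewrite -mulr_sumr ler_wpM2l // geometric_le.
have /andP[h3 h4] := expected_count_bounds uv q0 N1.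
set Q := q * N ^+ K in geo h3 h4 *; set mu := L * q ^+ K.+1 in h2 h3 h4.
have Q0 : 0 <= Q by rewrite mulr_ge0 ?exprn_ge0 // ltW.
have mu0 : 0 <= mu by rewrite mulr_ge0 ?exprn_ge0.
have pq : q ^+ K.+1 <= q by rewrite exprS ler_piMr // exprn_ile1.
have p0 : 0 <= q ^+ K.+1 by rewrite exprn_ge0.
have D0 : 0 <= m / N by rewrite divr_ge0 // ltW.
have h5 : L * (2 * q ^+ K.+1 * (q ^+ K.+1 + 2 * (30 * (m * q * N ^+ K / N)))) <=
    2 * (Q * (q + 60 * (m / N) * Q)).
  have -> : L * (2 * q ^+ K.+1 * (q ^+ K.+1 + 2 * (30 * (m * q * N ^+ K / N)))) =
      2 * (mu * (q ^+ K.+1 + 60 * (m / N) * Q)) by rewrite /mu /Q; ring.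
  have DQ : 0 <= 60 * (m / N) * Q by apply: mulr_ge0 => //; exact: mulr_ge0.
  rewrite ler_pM2l //; apply: ler_pM => //; first by rewrite addr_ge0.
  by rewrite lerD2r.
have h6 : `|c - mu| <= `|c - Q| + m ^+ 2 * q * Q.
  rewrite (_ : c - mu = (c - Q) + (Q - mu)); last by ring.
  apply: le_trans (ler_normD _ _) _; rewrite lerD2l ger0_norm ?subr_ge0 //.
  by rewrite lerBlDl.
apply: (le_trans (ler_distD _ _ _)); apply: (le_trans (lerD h1 h2)).
apply: (le_trans (lerD geo (lerD h6 h5))).
have -> : Q * (2 / N + m ^+ 2 * q + 2 * q + 120 * (m / N) * Q) =
  Q * (2 / N) + m ^+ 2 * q * Q + 2 * (Q * (q + 60 * (m / N) * Q)) by ring.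
by rewrite [leLHS](_ : _ = `|c - Q| + (Q * (2 / N) + m ^+ 2 * q * Q +
  2 * (Q * (q + 60 * (m / N) * Q)))) //; ring.
Qed.

End PoissonError.

(** * Asymptotics of the parameters *)

Lemma liminf_limsup_bounds (R : realType) (alpha : R^nat) :
  (0 < limn_einf (EFin \o alpha))%E -> (limn_esup (EFin \o alpha) < +oo)%E ->
  exists a b : R, 0 < a /\ \forall n \near \oo, a <= alpha n <= b.
Proof.
rewrite limn_einf_lim limn_esup_lim => hinf hsup.
have [i hi] : exists i, (0 < einfs (EFin \o alpha) i)%E.
  apply: contrapT => /forallNP h; move: hinf; apply/negP; rewrite -leNgt.
  apply: lime_le; first exact: is_cvg_einfs.
  by apply: nearW => i; rewrite leNgt; apply/negP/h.
have [j hj] : exists j, (esups (EFin \o alpha) j < +oo)%E.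
  apply: contrapT => /forallNP h; move: hsup; apply/negP; rewrite -leNgt.
  apply: lime_ge; first exact: is_cvg_esups.
  by apply: nearW => j; rewrite leNgt; apply/negP/h.
have ai k : (i <= k)%N -> (einfs (EFin \o alpha) i <= (alpha k)%:E)%E.
  by move=> ik; apply: ereal_inf_lbound; exists k.
have bj k : (j <= k)%N -> ((alpha k)%:E <= esups (EFin \o alpha) j)%E.
  by move=> jk; apply: ereal_sup_ubound; exists k.
(* The real values [alpha i] and [alpha j] exclude the remaining infinite cases of the two tail
   bounds. *)
have := ai i (leqnn i); have := bj j (leqnn j).
case: (einfs _ i) hi ai => [a| |] //; case: (esups _ j) hj bj => [b| |] //.
move=> _ bj a0 ai _ _; exists a, b; split; first by rewrite -lte_fin.
near=> n; rewrite -!lee_fin ai ?bj //; near: n; exact: nbhs_infty_ge.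
Unshelve. all: by end_near.
Qed.

Lemma cvg_ln_pinfty (R : realType) (f : R^nat) :
  f n @[n --> \oo] --> +oo -> ln (f n) @[n --> \oo] --> +oo.
Proof.
move=> /cvgryPge fy; apply/cvgryPge => A; near=> n.
rewrite -[A]expRK ler_ln ?posrE ?expR_gt0 //; first by near: n; exact: fy.
by apply: (lt_le_trans (expR_gt0 A)); near: n; exact: fy.
Unshelve. all: by end_near.
Qed.

Lemma cvg_pinftyV (R : realType) (f : R^nat) :
  f n @[n --> \oo] --> +oo -> (f n)^-1 @[n --> \oo] --> 0.
Proof.
by move=> fy; apply/gtr0_cvgV0 => //; move/cvgryPgt: fy; exact.
Qed.

(** One term of the exponential series gives [x = exp (ln x) >= (ln x)^4 / 4!], and [4! = 24]. *)
Lemma ln_cube_le (R : realType) (x : R) : 1 < x -> ln x ^+ 3 / x <= 24 / ln x.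
Proof.
move=> x1; have l0 := ln_gt0 x1; have x0 : 0 < x by lra.
rewrite ler_pdivrMr // mulrAC ler_pdivlMr // -exprSr.
have := series_exp_le l0 5; rewrite lnK ?posrE // => h.
suff : exp_coeff (ln x) 4 <= x.
  by rewrite /exp_coeff /= ler_pdivrMr ?ltr0n // mulrC.
apply: le_trans h; rewrite seriesSr lerDr.
by apply: sumr_ge0 => i _; exact/exp_coeff_ge0/ltW.
Qed.

Section Asymptotics.
Variables (R : realType) (alpha : R^nat) (lambda : R).
Hypothesis alpha_inf : (0 < limn_einf (EFin \o alpha))%E.
Hypothesis alpha_sup : (limn_esup (EFin \o alpha) < +oo)%E.
Hypothesis lambda_itv : 0 < lambda < 1.
Hypothesis lambda_cvg : lambda_seq alpha n @[n --> \oo] --> lambda.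

Local Notation c := (ln (1 / lambda)).
Let q n := edge_prob alpha n.
Let N n := n%:R * q n.
Let cn n := N n ^ dstar alpha n / n%:R.

Lemma rate_gt0 : 0 < c.
Proof.
have /andP[l0 l1] := lambda_itv.
by rewrite div1r ln_gt0 // invf_gt1.
Qed.

Lemma mean_path_count_cvg : cn n @[n --> \oo] --> c.
Proof.
have /andP[l0 l1] := lambda_itv.
have -> : cn = fun n => - ln (lambda_seq alpha n).
  by apply/funext => n; rewrite /lambda_seq expRK opprK.
rewrite div1r lnV ?posrE //; apply: cvgN.
exact: (cvg_comp _ _ lambda_cvg (continuous_ln l0)).
Qed.

Lemma mean_degreeE n : (0 < n)%N -> N n = alpha n * ln n%:R.
Proof.
by move=> n0; rewrite /N /q /edge_prob mulrC divfK // pnatr_eq0 -lt0n.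
Qed.

Lemma cvg_ln_nat : ln (n%:R : R) @[n --> \oo] --> +oo.
Proof. exact/cvg_ln_pinfty/cvgr_idn. Qed.

Lemma cvg_mean_degree : N n @[n --> \oo] --> +oo.
Proof.
have [a [b [a0 ab]]] := liminf_limsup_bounds alpha_inf alpha_sup.
have /cvgryPge lny := cvg_ln_nat.
apply/cvgryPge => A; near=> n.
have l0 : 0 <= ln (n%:R : R) by near: n; exact: lny.
rewrite mean_degreeE; last by near: n; exact: nbhs_infty_gt.
apply: (@le_trans _ _ (a * ln n%:R)).
  by rewrite -ler_pdivrMl //; near: n; exact: lny.
by rewrite ler_wpM2r //; have /andP[] : a <= alpha n <= b by near: n.
Unshelve. all: by end_near.
Qed.

(** This feeds [er_prob_poisson_error]: with [K + 1] for the length, the mean [q N^K] is [cn n], and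
    the null sequences [delta] and [eps] dominate the remaining error terms. *)
Lemma asymptotic_regime : exists delta eps : R^nat,
  [/\ delta n @[n --> \oo] --> 0, eps n @[n --> \oo] --> 0 &
  \forall n \near \oo, exists K : nat,
    [/\ dstar alpha n = K.+1, 4 <= N n & 0 <= q n <= 1] /\
    [/\ 12 * K.+2%:R ^+ 2 * q n <= 1, q n * N n ^+ K = cn n,
        K.+2%:R ^+ 2 * q n <= eps n & K.+2%:R / N n <= delta n]].
Proof.
have [a [b [a0 ab]]] := liminf_limsup_bounds alpha_inf alpha_sup.
have c0 := rate_gt0.
have NVy := cvg_pinftyV cvg_mean_degree.
have lnNVy := cvg_pinftyV (cvg_ln_pinfty cvg_mean_degree).
have lnVy := cvg_pinftyV cvg_ln_nat.
(* [delta] comes from [K + 1 <= 2 ln n / ln N] and [ln n <= N / a], with [1 / N] for passing to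
   [K + 2]. [eps] comes from [K + 2 <= N], which gives [(K + 2)^2 q <= N^3 / n <= b^3 (ln n)^3 /
   n]. *)
pose delta n := 2 / a * (ln (N n))^-1 + (N n)^-1.
pose eps n := 24 * b ^+ 3 * (ln (n%:R : R))^-1.
have delta0 : delta n @[n --> \oo] --> 0.
  rewrite -[X in _ --> X](_ : 2 / a * 0 + 0 = 0); last by rewrite mulr0 addr0.
  by apply: cvgD => //; apply: cvgM => //; exact: cvg_cst.
have eps0 : eps n @[n --> \oo] --> 0.
  rewrite -[X in _ --> X](_ : 24 * b ^+ 3 * 0 = 0); last by rewrite mulr0.
  by apply: cvgM => //; exact: cvg_cst.
exists delta, eps; split => //; near=> n.
have n1 : (1 < n)%N by near: n; exact: nbhs_infty_gt.
have n0 : 0 < n%:R :> R by rewrite ltr0n ltnW.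
have /andP[an bn] : a <= alpha n <= b by near: n.
have N4 : 4 <= N n by near: n; move/cvgryPge: cvg_mean_degree; exact.
have N0 : 0 < N n by lra.
have l0 : 0 < ln (n%:R : R) by rewrite ln_gt0 // ltr1n.
have lN0 : 0 < ln (N n) by rewrite ln_gt0 //; lra.
have NE := mean_degreeE (ltnW n1).
have cn_lo : c / 2 < cn n.
  by near: n; apply: (cvgr_gt c mean_path_count_cvg); lra.
have cn_hi : cn n < 2 * c.
  by near: n; apply: (cvgr_lt c mean_path_count_cvg); lra.
have nc : 2 * c <= n%:R by near: n; exact: nbhs_infty_ger.
have ncV : 2 / c <= n%:R by near: n; exact: nbhs_infty_ger.
have eps1 : eps n < 1 / 12 by near: n; apply: (cvgr_lt 0 eps0); lra.
have delta1 : delta n < 1 by near: n; exact: (cvgr_lt 0 delta0).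
have qN : q n = N n / n%:R by rewrite /N mulrC mulKf // gt_eqF.
have q0 : 0 < q n by rewrite qN divr_gt0.
have cnE : N n ^ dstar alpha n = cn n * n%:R by rewrite divfK // gt_eqF.
have cn1 : 1 < cn n * n%:R.
  apply: (@le_lt_trans _ _ (c / 2 * n%:R)); last by rewrite ltr_pM2r.
  rewrite -[leLHS](_ : c / 2 * (2 / c) = 1); last by field; rewrite gt_eqF.
  by rewrite ler_wpM2l // divr_ge0 // ltW.
(* As [N >= 1], a power of [N] above 1 has a positive exponent; this also excludes the default value
   0 of [dstar]. *)
have d0 : 0 < dstar alpha n.
  rewrite ltNge; apply/negP => d0.
  have N1 : 1 <= N n by apply: le_trans N4; rewrite ler1n.
  by have := ler_weXz2l N1 d0; rewrite cnE expr0z leNgt cn1.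
case dE: (dstar alpha n) d0 => [[|K]|] // _; exists K.
have {}cnE : N n ^+ K.+1 = cn n * n%:R by rewrite -cnE dE.
(* Since [cn n < 2 c <= n], the power [N^(K+1)] is at most [n^2]; taking logarithms gives the factor
   2. *)
have lnN : K.+1%:R * ln (N n) <= 2 / a * N n.
  rewrite mulr_natl -lnXn // cnE.
  apply: (@le_trans _ _ (ln (n%:R * n%:R))).
    rewrite ler_ln ?posrE ?(mulr_gt0 n0 n0) ?(lt_trans ltr01 cn1) //.
    by rewrite ler_pM2r // (le_trans (ltW cn_hi)).
  rewrite lnM ?posrE // NE mulrAC ler_pdivlMr //.
  rewrite -[ln _ + _]mulr2n -[ln _ *+ 2]mulr_natl -mulrA ler_pM2l // mulrC.
  by rewrite ler_pM2r.
have mN : K.+2%:R / N n <= delta n.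
  rewrite -natr1 mulrDl mul1r lerD2r ler_pdivrMr //.
  by rewrite mulrAC ler_pdivlMr.
have mleN : K.+2%:R <= N n.
  by rewrite -[N n]mul1r -ler_pdivrMr // (le_trans mN) // ltW.
have b0 : 0 <= b by apply: le_trans (ltW a0) (le_trans an bn).
have m2q : K.+2%:R ^+ 2 * q n <= eps n.
  apply: (@le_trans _ _ (N n ^+ 2 * q n)).
    by rewrite ler_wpM2r ?(ltW q0) // lerXn2r ?nnegrE // ltW.
  rewrite qN mulrA -exprSr.
  apply: (@le_trans _ _ (b ^+ 3 * (ln n%:R ^+ 3 / n%:R))).
    rewrite mulrA ler_pM2r ?invr_gt0 // -exprMn lerXn2r ?nnegrE ?(ltW N0) //.
      by rewrite mulr_ge0 // ltW.
    by rewrite NE ler_pM2r.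
  rewrite /eps (mulrC 24) -[leRHS]mulrA ler_wpM2l ?exprn_ge0 //.
  by apply: ln_cube_le; rewrite ltr1n.
have q_m2 : q n <= K.+2%:R ^+ 2 * q n.
  by rewrite ler_peMl ?(ltW q0) // -natrX ler1n.
split; split => //.
- rewrite (ltW q0) (le_trans q_m2) // (le_trans m2q) // (le_trans (ltW eps1)) //.
  by rewrite ler_pdivrMr // mul1r ler1n.
- rewrite -mulrA -ler_pdivlMl // mulr1; apply: le_trans m2q _.
  by rewrite ltW // -[12^-1]mul1r.
- by rewrite qN mulrAC -exprS cnE mulfK // gt_eqF.
Unshelve. all: by end_near.
Qed.

End Asymptotics.

(* Vertices 1, ..., m are encoded as the elements 0, ..., m - 1 of 'I_m, so
   that the vertices 1 and 2 are ord0 and lift ord0 ord0; m = n.+2 >= 2. *)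
Theorem theorem3p7 (R : realType) (alpha : R^nat) (lambda : R)
  (alpha_gt0 : forall n, 0 < alpha n)
  (alpha_inf : (0 < limn_einf (EFin \o alpha))%E)
  (alpha_sup : (limn_esup (EFin \o alpha) < +oo)%E)
  (dstar_odd : \forall n \near \oo, odd `|dstar alpha n|%N)
  (lambda_itv : 0 < lambda < 1)
  (lambda_cvg : lambda_seq alpha n @[n --> \oo] --> lambda) :
  er_prob (edge_prob alpha n.+2)
    [set G : sgraph 'I_n.+2 |
      unique_shortest_path_of_length G ord0 (lift ord0 ord0)
        (dstar alpha n.+2)]
    @[n --> \oo] --> lambda * ln (1 / lambda).
Proof.
have [delta [eps [delta0 eps0 [M _ regime]]]] :=
  asymptotic_regime alpha_inf alpha_sup lambda_itv lambda_cvg.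
have c0 := rate_gt0 lambda_itv.
have cn_cvg := mean_path_count_cvg lambda_itv lambda_cvg.
set c := ln (1 / lambda) in c0 cn_cvg *.
set cn : R^nat := fun n => _ in cn_cvg.
(* The error bound at mean [cn n], with [1 / N] and [(K + 2) / N] bounded by [delta], and
   [(K + 2)^2 q + 2 q] by [3 eps]. *)
pose B n :=
  `|c - cn n| + cn n * (2 * delta n + 3 * eps n + 120 * delta n * cn n).
have B0 : B n @[n --> \oo] --> 0.
  have -> : 0 = `|c - c| + c * (2 * 0 + 3 * 0 + 120 * 0 * c) :> R.
    by rewrite subrr normr0; ring.
  apply: cvgD; first by apply: cvg_norm; apply: cvgB => //; exact: cvg_cst.
  apply: cvgM => //; apply: cvgD.
    by apply: cvgD; apply: cvgM => //; exact: cvg_cst.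
  by apply: cvgM => //; apply: cvgM => //; exact: cvg_cst.
have {}B0 : B n.+2 @[n --> \oo] --> 0.
  by move: B0; rewrite -(cvg_shiftn 2) /=; under eq_fun do rewrite addn2.
(* As [lambda = exp (- c)], the limit is the mass at 1 of the Poisson law of mean [c]. *)
have limE : lambda * c = c * expR (- c).
  have /andP[l0 _] := lambda_itv.
  by rewrite /c div1r lnV ?posrE // opprK lnK ?posrE // mulrC.
rewrite limE; apply/cvgrPdist_le => e e0; near=> n.
have Be : B n.+2 <= e.
  near: n; move/cvgrPdist_le: B0 => /(_ _ e0); apply: filterS => n.
  by rewrite sub0r normrN; apply: le_trans; exact: ler_norm.
have Mn : (M <= n.+2)%N.
  by apply: leqW; apply: leqW; near: n; exact: nbhs_infty_ge.
have [K [[dE N4 q01] [m2q cnE m2qe mN]]] := regime _ Mn.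
apply: le_trans Be; rewrite distrC dE.
have uv : ord0 != lift ord0 ord0 :> 'I_n.+2 by [].
have := @er_prob_poisson_error R 'I_n.+2 _ c _ _ K uv c0 q01.
rewrite card_ord => /(_ N4 m2q) h; apply: (le_trans h).
rewrite cnE lerD2l; have [q0 q1] := andP q01.
have N0 : 0 < n.+2%:R * edge_prob alpha n.+2.
  by apply: lt_le_trans N4; rewrite ltr0n.
have cn0 : 0 <= cn n.+2 by rewrite /cn -cnE mulr_ge0 // exprn_ge0 // ltW.
rewrite ler_wpM2l //.
have m1 : 2 / (n.+2%:R * edge_prob alpha n.+2) <= 2 * delta n.+2.
  rewrite ler_pM2l //; apply: le_trans mN; rewrite -[leLHS]mul1r.
  by rewrite ler_pM2r ?invr_gt0 // ler1n.
have q_m2 : edge_prob alpha n.+2 <= K.+2%:R ^+ 2 * edge_prob alpha n.+2.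
  by rewrite ler_peMl // -natrX ler1n.
apply: lerD; last by rewrite ler_wpM2r // ler_pM2l.
rewrite (_ : 3 * eps n.+2 = eps n.+2 + 2 * eps n.+2); last by ring.
rewrite addrA; apply: lerD; first exact: lerD.
by rewrite ler_pM2l // (le_trans q_m2).
Unshelve. all: by end_near.
Qed.
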